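(* Let $\{b_i\}_{i\in\mathbb{N}}$ be a set of pairwise coprime odd numbers greater than one and let $\mathscr{B}=\{2^ib_i\}_{i\in\mathbb{N}}$. Then the automorphism group of the $\mathscr{B}$-free subshift $(X_\eta,S)$ is trivial, i.e. every homeomorphism $U\colon X_\eta\to X_\eta$ with $U\circ S=S\circ U$ is of the form $U=S^n|_{X_\eta}$ for some $n\in\mathbb{Z}$.
   Context: $\mathbb{N}=\{1,2,3,\ldots\}$; ''pairwise coprime'' means $\gcd(b_i,b_j)=1$ for $i\neq j$. The space $\{0,1\}^{\mathbb{Z}}$ carries the product topology, and $S$ is the left shift, $(Sx)(m)=x(m+1)$ for $m\in\mathbb{Z}$. For $\mathscr{B}\subset\mathbb{N}$, put $\mathcal{M}_{\mathscr{B}}=\bigcup_{b\in\mathscr{B}}b\mathbb{Z}$, $\mathcal{F}_{\mathscr{B}}=\mathbb{Z}\setminus\mathcal{M}_{\mathscr{B}}$ (the $\mathscr{B}$-free numbers), and let $\eta\in\{0,1\}^{\mathbb{Z}}$ be the characteristic function of $\mathcal{F}_{\mathscr{B}}$. The $\mathscr{B}$-free subshift is $(X_\eta,S)$, where $X_\eta=\overline{\{S^n\eta : n\in\mathbb{Z}\}}$. The automorphism group $C(S)$ of $(X_\eta,S)$ is the group of all homeomorphisms $U\colon X_\eta\to X_\eta$ commuting with $S$; it is called trivial if it consists solely of powers of the shift. *)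

(* Defs.v *)
From HB Require Import structures.
From mathcomp Require Import all_boot all_order all_algebra.
From mathcomp Require Import all_classical.
From mathcomp Require Import topology.

Set Implicit Arguments.
Unset Strict Implicit.
Unset Printing Implicit Defensive.

Import GRing.Theory.

Local Open Scope classical_set_scope.
Local Open Scope ring_scope.

(* [bool] carries the discrete topology, [{ptws _ -> _}] the product one. *)
Definition fullshift : topologicalType := {ptws int -> bool}.

Definition shift (x : fullshift) : fullshift := fun m => x (m + 1).

(* [shiftz n] is the n-th power of [shift], for any n : int; see [shiftz1],
   [shiftz0] and [shiftzD]. *)
Definition shiftz (n : int) (x : fullshift) : fullshift := fun m => x (m + n).

Lemma shiftz1 : shiftz 1 = shift.
Proof. by []. Qed.

Lemma shiftz0 : shiftz 0 = id.
Proof. by apply/funext => x; apply/funext => m; rewrite /shiftz addr0. Qed.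

Lemma shiftzD (n p : int) : shiftz (n + p) = shiftz n \o shiftz p.
Proof. by apply/funext => x; apply/funext => m; rewrite /shiftz /= addrA. Qed.

Definition multiples (B : set nat) : set int :=
  \bigcup_(b in B) [set b%:Z * k | k in [set: int]].

Definition bfree (B : set nat) : set int := ~` multiples B.

Definition eta (B : set nat) : fullshift := fun m => m \in bfree B.

Definition bfree_subshift (B : set nat) : set fullshift :=
  closure [set shiftz n (eta B) | n in [set: int]].

(* A self-homeomorphism of the subspace A is represented by a total function
   on T, whose values outside of A are irrelevant. *)
Definition self_homeomorphism (T : topologicalType) (A : set T) (U : T -> T) :=
  [/\ set_fun A A U, {within A, continuous U} &
      exists V : T -> T,
        [/\ set_fun A A V, {within A, continuous V},
            forall x, A x -> V (U x) = x & forall x, A x -> U (V x) = x]].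

Definition automorphism_group (X : set fullshift) : set (fullshift -> fullshift) :=
  [set U | self_homeomorphism X U /\
           forall x, X x -> U (shift x) = shift (U x)].

Definition trivial_automorphism_group (X : set fullshift) :=
  forall U, automorphism_group X U ->
    exists n : int, forall x, X x -> U x = shiftz n x.

(* Main.v *)
(* A position q is a hole of level N if 2^N divides q but no b_i with
   1 <= i <= N does. With L_N := 2^N b_1 ... b_N, eta is constant on the class
   of q modulo L_N unless q is a hole, and then it takes both values there, by
   solvability of q + k L_N = 0 mod 2^(N+1) b_(N+1).

   An endomorphism U is a block code of some radius R, so any position on whose
   class modulo L_N the point y := U eta is nonconstant is within R of a hole
   of eta. On a long window, y agrees with some S^n eta, whose level-N holes
   are those of eta moved by -n. As holes of eta lie in 2^N Z, as soon as
   2^N > 2R this forces n = c mod 2^N with |c| <= R and holes of eta moved by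
   c - n are holes again; the Chinese remainder theorem upgrades this to n = c
   mod L_N. Hence y = S^c eta on [-2^N + R + 1, 2^N - R - 1], some c in [-R, R]
   serves infinitely many N, and U = S^c on the orbit of eta, hence on its
   closure. *)
Require Import Defs.
From mathcomp Require Import all_boot all_order all_algebra.
From mathcomp Require Import all_classical.
From mathcomp Require Import topology.
From mathcomp Require Import zify ring.

Set Implicit Arguments.
Unset Strict Implicit.
Unset Printing Implicit Defensive.

Import Order.TTheory GRing.Theory Num.Theory.

Local Open Scope classical_set_scope.
Local Open Scope nat_scope.

(** * Cylinders of the full shift, and locality of continuous maps *)

Definition cyl (W : nat) (x : fullshift) : set fullshift :=
  [set z | forall m : int, `|m| <= W -> z m = x m].

Lemma nbhs_coord (x : fullshift) (m : int) :
  nbhs x [set z : fullshift | z m = x m].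
Proof.
have := @proj_continuous int (fun=> bool) m x [set x m].
apply; rewrite /= nbhs_principalE; exact/principal_filterP.
Qed.

Lemma nbhs_cyl (W : nat) (x : fullshift) : nbhs x (cyl W x).
Proof.
elim: W => [|W IH].
  apply: filterS (nbhs_coord x 0%R) => z zx m; rewrite leqn0 absz_eq0 => /eqP->.
  exact: zx.
apply: filterS (filterI IH
  (filterI (nbhs_coord x W.+1%:Z) (nbhs_coord x (- W.+1%:Z)%R))).
move=> z [h [/= h1 h2]] m; rewrite leq_eqVlt => /orP[|];
  last by rewrite ltnS => /h.
case: (intP m) => [|n|n].
- by [].
- by rewrite absz_nat => /eqP [->].
- by rewrite abszN absz_nat => /eqP [->].
Qed.

Lemma cvg_fullshift (F : set_system fullshift) (x : fullshift) : Filter F ->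
  (forall m, F [set z | z m = x m]) -> F --> x.
Proof.
move=> FF h; apply/cvg_sup => m; apply/cvg_image.
  by rewrite eqEsubset; split=> v // _; exists (fun=> v).
move=> V /= Vx; exists [set z : fullshift | V (z m)].
  apply: filterS (h m) => z /= ->; exact: nbhs_singleton Vx.
rewrite eqEsubset; split=> [_ [z /= Vz <-]//|v Vv]; by exists (fun=> v).
Qed.

(** The sets [cyl W x] generate a filter that settles every coordinate at its value in [x]; by
    [cvg_fullshift] it converges to [x]. *)
Lemma cyl_basis (x : fullshift) (A : set fullshift) :
  nbhs x A -> exists W, cyl W x `<=` A.
Proof.
move=> xA; pose F := filter_from setT (fun W => cyl W x).
have FF : Filter F.
  apply: filter_from_filter; first by exists 0.
  move=> i j _ _; exists (maxn i j) => // z h.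
  by split=> m hm; apply: h; rewrite leq_max hm ?orbT.
have Fx : F --> x.
  by apply: cvg_fullshift => m; exists `|m|%N => // z; apply.
by have [W _ h] := Fx _ xA; exists W.
Qed.

Lemma compact_closed_fullshift (X : set fullshift) : closed X -> compact X.
Proof.
move=> cX; apply: (subclosed_compact (B := setT)) => //.
have := @tychonoff int (fun=> bool) (fun=> setT) (fun=> bool_compact).
by congr (compact _); rewrite eqEsubset; split.
Qed.

Lemma within_cyl (X : set fullshift) (U : fullshift -> fullshift)
    (x : fullshift) (m : int) : {within X, continuous U} -> X x ->
  exists W, forall z, X z -> cyl W x z -> U z m = U x m.
Proof.
move=> /subspace_continuousP /(_ x) cU Xx.
have := cU Xx _ (nbhs_coord (U x) m).
rewrite /= => /cyl_basis [W hW]; exists W => z Xz Wz.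
exact: hW.
Qed.

(** Compactness: if every radius fails, the first members of the bad pairs accumulate at some [x] in
    [X]. Continuity at [x] supplies a window [W] determining coordinate 0 of the image, and a bad
    pair of radius at least [W] whose first member is near [x] has both members agreeing with [x]
    there. *)
Lemma block_code (X : set fullshift) (U : fullshift -> fullshift) : closed X ->
  {within X, continuous U} ->
  exists R, forall x y, X x -> X y -> cyl R x y -> U x 0%R = U y 0%R.
Proof.
move=> /compact_closed_fullshift cX cU; apply: contrapT => nR.
have {}nR R : exists xy : fullshift * fullshift,
    [/\ X xy.1, X xy.2, cyl R xy.1 xy.2 & U xy.1 0%R <> U xy.2 0%R].
  apply: contrapT => h; apply: nR; exists R => x y Xx Xy xy.
  by apply: contrapT => e; apply: h; exists (x, y).
have [f hf] := choice nR.
have [] := cX ((fun R => (f R).1) @ \oo).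
- by exists 0 => // R _; case: (hf R).
move=> x [Xx clx].
have [W hW] := within_cyl 0%R cU Xx.
have : (fst \o f @ \oo) [set (f R).1 | R in [set R | W <= R]].
  by exists W => // R hR; exists R.
move=> /clx /(_ (nbhs_cyl W x)) [z [[R hR <-] xz]].
have [X1 X2 c12] := hf R; apply.
rewrite !hW // => m hm; rewrite c12 ?xz //; exact: leq_trans hR.
Qed.

(** * Arithmetic of the holes of eta *)

Section Toeplitz.
Context (b : nat -> nat).
Hypothesis b_gt1 : forall i, 0 < i -> 1 < b i.
Hypothesis b_odd : forall i, 0 < i -> odd (b i).
Hypothesis b_coprime :
  forall i j, 0 < i -> 0 < j -> i <> j -> coprime (b i) (b j).

Local Notation B := [set 2 ^ i * b i | i in [set i | 0 < i]].
Local Notation eta := (eta B).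

Lemma etaP (q : int) :
  reflect (exists2 i, 0 < i & ((2 ^ i * b i)%:Z %| q)%Z) (~~ eta q).
Proof.
apply: (iffP idP) => [|[i i0 iq]].
  rewrite notin_setE /bfree /= notK => -[_ [i i0 <-] [k _ <-]].
  by exists i => //; apply: dvdz_mulr.
rewrite notin_setE /bfree /= notK; exists (2 ^ i * b i); first by exists i.
by case/dvdzP: iq => k ->; exists k => //; rewrite mulrC.
Qed.

Definition bprod (N : nat) : nat := \prod_(1 <= i < N.+1) b i.

Definition period (N : nat) : nat := 2 ^ N * bprod N.

Definition hole (N : nat) (q : int) : Prop :=
  ((2 ^ N)%N%:Z %| q)%Z /\ forall i, 0 < i <= N -> ~~ ((b i)%:Z %| q)%Z.

Lemma dvd_bprod N i : 0 < i <= N -> b i %| bprod N.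
Proof.
move=> /andP[i0 iN]; rewrite /bprod (big_cat_nat (n := i)) //=; last lia.
by rewrite [X in _ * X]big_ltn //; apply/dvdn_mull/dvdn_mulr.
Qed.

Lemma coprime_prod_b N m (P : pred nat) :
  (forall i, 0 < i <= N -> P i -> coprime m (b i)) ->
  coprime m (\prod_(1 <= i < N.+1 | P i) b i).
Proof.
move=> h; rewrite big_nat_cond; apply: (big_ind (coprime m)).
- exact: coprimen1.
- by move=> x y mx my; rewrite coprimeMr mx.
- by move=> i /andP[iN Pi]; apply: h.
Qed.

Lemma coprime_bprod N m :
  (forall i, 0 < i <= N -> coprime m (b i)) -> coprime m (bprod N).
Proof. by move=> h; apply: coprime_prod_b => i iN _; apply: h. Qed.

Lemma coprime_pow2_b N i : 0 < i -> coprime (2 ^ N) (b i).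
Proof. by move=> i0; rewrite coprimeXl // coprime2n b_odd. Qed.

Lemma bprod_dvdz N (q : int) :
  (forall i, 0 < i <= N -> ((b i)%:Z %| q)%Z) -> ((bprod N)%:Z %| q)%Z.
Proof.
rewrite /bprod; elim: N => [|N IH] h; first by rewrite big_geq ?dvd1z.
rewrite big_nat_recr //= PoszM Gauss_dvdz ?IH ?h //= ?leqnn //.
  by move=> i /andP[i0 iN]; apply: h; rewrite i0 leqW.
rewrite coprimezE !absz_nat coprime_sym coprime_bprod // => i /andP[i0 iN].
by apply: b_coprime => //; lia.
Qed.

Lemma period_dvdz N (q : int) : ((2 ^ N)%N%:Z %| q)%Z ->
  (forall i, 0 < i <= N -> ((b i)%:Z %| q)%Z) -> ((period N)%:Z %| q)%Z.
Proof.
move=> h2 hb; rewrite /period PoszM Gauss_dvdz ?h2 ?bprod_dvdz //.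
rewrite coprimezE !absz_nat; apply: coprime_bprod => i /andP[i0 _].
exact: coprime_pow2_b.
Qed.

Lemma b_dvd_period N i : 0 < i <= N -> (((b i)%:Z %| (period N)%:Z)%Z).
Proof. by move=> iN; rewrite dvdzE !absz_nat dvdn_mull ?dvd_bprod. Qed.

Lemma pow2_dvd_period N : ((2 ^ N)%N%:Z %| (period N)%:Z)%Z.
Proof. by rewrite dvdzE !absz_nat dvdn_mulr. Qed.

Lemma period_gt0 N : 0 < period N.
Proof.
rewrite muln_gt0 expn_gt0 /= /bprod big_nat_cond prodn_cond_gt0 // => i.
by move=> /andP[/andP[i0 _] _]; rewrite ltnW ?b_gt1.
Qed.

Lemma dvdz_mod_period d N (q r : int) : ((d %| (period N)%:Z)%Z) ->
  ((period N)%:Z %| (r - q)%R)%Z -> (d %| r)%Z = (d %| q)%Z.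
Proof.
move=> dN Nr; rewrite -(subrK q r) rpredDl //; exact: dvdz_trans Nr.
Qed.

Lemma hole_mod N (q r : int) : ((period N)%:Z %| (r - q)%R)%Z ->
  hole N q -> hole N r.
Proof.
move=> qr [h2 hb]; split.
  by rewrite (dvdz_mod_period _ qr) ?pow2_dvd_period.
by move=> i iN; rewrite (dvdz_mod_period _ qr) ?hb ?b_dvd_period.
Qed.

Lemma scale_dvdz i (q : int) :
  0 < i ->
  ((2 ^ i * b i)%N%:Z %| q)%Z = ((2 ^ i)%N%:Z %| q)%Z && ((b i)%:Z %| q)%Z.
Proof.
move=> i0; rewrite PoszM Gauss_dvdz // coprimezE !absz_nat; exact: coprime_pow2_b.
Qed.

(** If the divisor 2^i b_i of [q] has i > N, then 2^N divides [q], so a non-hole [q] is divisible by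
    some b_j with j <= N, hence by 2^j b_j. A divisor of that level divides [period N], so it passes
    to [r]. *)
Lemma nonhole_eta_le N (q r : int) : ((period N)%:Z %| (r - q)%R)%Z ->
  ~ hole N q -> ~~ eta q -> ~~ eta r.
Proof.
move=> qr nh /etaP [i i0]; rewrite scale_dvdz // => /andP[q2 qb].
have {nh} [j [j0 jN jr]] : exists j,
    [/\ 0 < j, j <= N & ((2 ^ j * b j)%N%:Z %| q)%Z].
  case: (leqP i N) => [iN|Ni]; first by exists i; rewrite scale_dvdz ?q2.
  have {}q2 : ((2 ^ N)%N%:Z %| q)%Z.
    by apply: dvdz_trans q2; rewrite dvdzE !absz_nat dvdn_exp2l // ltnW.
  apply: contrapT => nj; apply: nh; split=> // j /andP[j0 jN]; apply/negP => jq.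
  apply: nj; exists j; split=> //; rewrite scale_dvdz // jq andbT.
  by apply: dvdz_trans q2; rewrite dvdzE !absz_nat dvdn_exp2l.
apply/etaP; exists j => //; rewrite (dvdz_mod_period _ qr) //.
rewrite dvdzE !absz_nat dvdn_mul ?dvd_bprod ?j0 //; exact: dvdn_exp2l.
Qed.

Lemma nonhole_eta N (q r : int) : ((period N)%:Z %| (r - q)%R)%Z ->
  ~ hole N q -> eta r = eta q.
Proof.
move=> qr nh; apply: negb_inj; apply/idP/idP; last exact: (nonhole_eta_le qr nh).
have rq : ((period N)%:Z %| (q - r)%R)%Z by rewrite -opprB rpredN.
by apply: (nonhole_eta_le rq) => /(hole_mod rq).
Qed.

Lemma coprime_bprod_next N : coprime (bprod N) (2 * b N.+1).
Proof.
rewrite coprime_sym; apply: coprime_bprod => i /andP[i0 iN].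
rewrite coprimeMl coprime2n b_odd //=; apply: b_coprime => //; lia.
Qed.

(* Dividing by 2^N, some k makes q + k L_N a multiple of 2^(N+1) b_(N+1), and
   then q + (k + 1) L_N has 2-adic valuation N. *)
Lemma hole_flip N (q : int) : hole N q ->
  exists2 k : nat, k <= 2 * b N.+1 & eta (q + (k * period N)%N%:Z)%R != eta q.
Proof.
move=> [q2 qb]; set M := 2 * b N.+1; set P := bprod N.
have M0 : 0 < M by rewrite muln_gt0 /= ltnW ?b_gt1.
have [q' qE] : exists q', q = (q' * (2 ^ N)%N%:Z)%R.
  by case/dvdzP: q2 => q'; exists q'.
have [k kM kP] : exists2 k : nat, k < M & (M%:Z %| (q' + k%:Z * P%:Z)%R)%Z.
  have /coprimezP [[u v] /= uv] : coprimez P%:Z M%:Z by exact: coprime_bprod_next.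
  (* The Bezout relation u P + v M = 1 solves q' + k P = 0 mod M by k = - q' u; reducing it mod M
     gives k < M, so k + 1 also meets the bound. *)
  exists `|(- q' * u) %% M%:Z|%Z%N.
    by rewrite -ltz_nat gez0_abs ?modz_ge0 ?ltz_pmod //; lia.
  rewrite gez0_abs ?modz_ge0 //; last lia.
  have := divz_eq (- q' * u)%R M%:Z; set a := (_ %/ _)%Z; set r := (_ %% _)%Z => e.
  apply/dvdzP; exists (q' * v - a * P%:Z)%R.
  have -> : r = (- q' * u - a * M%:Z)%R by rewrite e; ring.
  have -> : (q' + (- q' * u - a * M%:Z) * P%:Z =
    q' * (1 - u * P%:Z) - a * P%:Z * M%:Z)%R by ring.
  by rewrite -uv; ring.
have qkE j : (q + (j * period N)%N%:Z = (q' + j%:Z * P%:Z) * (2 ^ N)%N%:Z)%R.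
  by rewrite qE /period -/P !PoszM; ring.
have etak : ~~ eta (q + (k * period N)%N%:Z)%R.
  apply/etaP; exists N.+1 => //; rewrite qkE expnS mulnAC -/M PoszM.
  by rewrite dvdz_mul.
(* Some i <= N would make b_i divide the hole [q]. Some i > N would make q' + (k + 1) P even,
   although q' + k P is even and P is odd. *)
have etak1 : eta (q + (k.+1 * period N)%N%:Z)%R.
  apply: contraT => /etaP [i i0]; rewrite scale_dvdz // => /andP[i2 ib].
  have [iN|Ni] := leqP i N.
    have iN' : 0 < i <= N by rewrite i0.
    have /negP[] := qb i iN'.
    rewrite -(dvdz_mod_period (b_dvd_period iN')
      (r := q + (k.+1 * period N)%N%:Z)) //.
    by rewrite addrAC subrr add0r PoszM dvdz_mull.
  have : ((2 ^ N.+1)%N%:Z %| (q + (k.+1 * period N)%N%:Z)%R)%Z.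
    by apply: dvdz_trans i2; rewrite dvdzE !absz_nat dvdn_exp2l.
  rewrite qkE expnS PoszM dvdz_mul2r; last by rewrite eqz_nat -lt0n expn_gt0.
  have -> : (q' + k.+1%:Z * P%:Z = P%:Z + (q' + k%:Z * P%:Z))%R by lia.
  rewrite rpredDr; last first.
    by apply: dvdz_trans kP; rewrite dvdzE !absz_nat dvdn_mulr.
  rewrite dvdzE !absz_nat dvdn2 => /negP[].
  by have := coprime_bprod_next N; rewrite coprimeMr coprimen2 => /andP[].
have [_|_] := boolP (eta q).
  by exists k; [exact: ltnW|rewrite (negbTE etak)].
by exists k.+1; [exact: kM|rewrite etak1].
Qed.

(** The only multiple of 2^N in this range is 0, which b_1 divides. *)
Lemma small_nonhole N (q : int) : 0 < N -> `|q| < 2 ^ N -> ~ hole N q.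
Proof.
move=> N0 qN [q2 /(_ 1%N) /(_ N0) /negP]; apply.
suff -> : q = 0%R by rewrite dvdz0.
apply/eqP; rewrite -absz_eq0 -leqn0 leqNgt; apply/negP => q0.
by have := dvdn_leq q0 q2; rewrite absz_nat leqNgt qN.
Qed.

(** * Aligning the holes of the image with those of eta *)

Section Alignment.
Context (y : fullshift) (R N : nat) (n : int).
Hypothesis y_block : forall i j : int,
  (forall d : int, `|d| <= R -> eta (i + d)%R = eta (j + d)%R) -> y i = y j.
Hypothesis y_eta : forall m : int,
  `|m| <= (2 * b N.+1).+1 * period N -> y m = eta (m + n)%R.

(** Without a hole within [R] of q - n, eta looks the same around any two positions of that class,
    so [y] is constant on it; but there [y] copies eta on the class of the hole [q], where
    [hole_flip] finds two values. *)
Lemma hole_near (q : int) : hole N q ->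
  exists2 d : int, `|d| <= R & hole N (q - n + d)%R.
Proof.
move=> hq; apply: contrapT => nh; set P := period N.
have P0 : (0 < P)%N by exact: period_gt0.
(* The residue [m] lies in [0, P), so both [m] and m + k P stay in the window of [y_eta]. *)
have := divz_eq (q - n)%R P%:Z; set a := (_ %/ _)%Z; set m := (_ %% _)%Z => e.
have m0 : (0 <= m)%R by rewrite modz_ge0 //; lia.
have mP : (m < P%:Z)%R by rewrite ltz_pmod.
have hm : hole N (m + n)%R.
  apply: hole_mod hq; rewrite -/P; have -> : (m + n - q = - a * P%:Z)%R by lia.
  exact: dvdz_mull.
have [k kM] := hole_flip hm; case/eqP.
have kP : k * P <= 2 * b N.+1 * P by rewrite leq_mul.
rewrite addrAC -!y_eta; last 2 first.
- by rewrite mulSn -/P; lia.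
- by rewrite mulSn -/P; lia.
apply: y_block => d dR; rewrite addrAC; apply: (@nonhole_eta N).
  by rewrite (addrC (m + d)%R) addrK PoszM dvdz_mull.
move=> hd; apply: nh; exists d => //; apply: hole_mod hd; rewrite -/P.
rewrite e; have -> : (a * P%:Z + m + d - (m + d) = a * P%:Z)%R by ring.
exact: dvdz_mull.
Qed.

Lemma alignment : 2 * R < 2 ^ N ->
  exists2 c : int, `|c| <= R & ((period N)%:Z %| (n - c)%R)%Z.
Proof.
move=> RN; have b2 i : 0 < i -> ~~ ((b i)%:Z %| (2 ^ N)%N%:Z)%Z.
  move=> i0; rewrite dvdzE !absz_nat; apply/negP => bi.
  have := coprime_pow2_b N i0; rewrite coprime_sym /coprime => /eqP g.
  have : b i %| gcdn (b i) (2 ^ N) by rewrite dvdn_gcd dvdnn.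
  by rewrite g dvdn1 => /eqP bi1; have := b_gt1 i0; rewrite bi1.
(* 2^N is itself a hole, since the b_i are odd and greater than 1; the hole near 2^N - n fixes [c]
   modulo 2^N. *)
have [|c cR [c2 _]] := @hole_near (2 ^ N)%N%:Z.
  by split=> // i /andP[i0 _]; exact: b2.
have {}c2 : ((2 ^ N)%N%:Z %| (n - c)%R)%Z.
  have -> : (n - c = (2 ^ N)%N%:Z - ((2 ^ N)%N%:Z - n + c))%R by ring.
  by rewrite rpredB.
exists c => //; apply: period_dvdz => // i /andP[i0 iN].
apply: contraT => nb.
(* If b_i does not divide n - c, the Chinese remainder theorem gives a hole [q] congruent to n - c
   mod b_i and to 2^N mod every other factor. *)
set Q := (2 ^ N * \prod_(1 <= j < N.+1 | j != i) b j)%N.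
have coQ : coprimez (b i)%:Z Q%:Z.
  rewrite coprimezE !absz_nat coprimeMr coprime_sym coprime_pow2_b //=.
  by apply: coprime_prod_b => j /andP[j0 _] /eqP ij; apply: b_coprime => // /esym.
have dvdQ j : 0 < j <= N -> j != i -> ((b j)%:Z %| Q%:Z)%Z.
  move=> /andP[j0 jN] ji; rewrite dvdzE !absz_nat dvdn_mull // big_mkcond /=.
  rewrite (bigD1_seq j) ?iota_uniq ?mem_index_iota ?j0 //= ji; exact: dvdn_mulr.
pose q := zchinese (b i)%:Z Q%:Z (n - c)%R (2 ^ N)%N%:Z.
have q1 : ((b i)%:Z %| (q - (n - c))%R)%Z.
  by rewrite -eqz_mod_dvd; apply/eqP/zchinese_modl.
have q2 : (Q%:Z %| (q - (2 ^ N)%N%:Z)%R)%Z.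
  by rewrite -eqz_mod_dvd; apply/eqP/zchinese_modr.
have q2N : ((2 ^ N)%N%:Z %| q)%Z.
  rewrite -(subrK (Posz (2 ^ N)) q) rpredDr //.
  by apply: dvdz_trans q2; rewrite PoszM dvdz_mulr.
have hq : hole N q.
  split=> // j jN; have [->|ji] := eqVneq j i.
    by rewrite -(subrK (n - c)%R q) rpredDl.
  rewrite -(subrK (Posz (2 ^ N)) q) rpredDl ?b2 //; first by case/andP: jN.
  by apply: dvdz_trans q2; exact: dvdQ.
have [d dR [d2 db]] := hole_near hq.
(* Both are congruent to [n] mod 2^N and differ by at most 2R < 2^N. Hence q - n + c is a hole, yet
   b_i divides it by the choice of [q]. *)
have dc : d = c.
  have : ((2 ^ N)%N%:Z %| (d - c)%R)%Z.
    have -> : (d - c = q - n + d - q + (n - c))%R by ring.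
    by apply: rpredD => //; apply: rpredB.
  rewrite dvdzE absz_nat => h; apply/eqP; rewrite -subr_eq0 -absz_eq0.
  rewrite -leqn0 leqNgt; apply/negP => dc0; have := dvdn_leq dc0 h.
  rewrite leqNgt (leq_ltn_trans _ RN) //.
  by clear -dR cR; lia.
have /negP[] := db i (introT andP (conj i0 iN)).
by rewrite dc; have -> : (q - n + c = q - (n - c))%R by ring.
Qed.

Lemma block_image_eta : 2 * R < 2 ^ N -> 0 < N ->
  exists2 c : int, `|c| <= R &
    forall p : int, `|p| + R < 2 ^ N -> y p = eta (p + c)%R.
Proof.
move=> RN N0; have [c cR nc] := alignment RN; exists c => // p pN.
rewrite y_eta; last first.
  apply: leq_trans (leq_pmull _ _) => //; apply: leq_trans (leq_pmulr _ _); first lia.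
  by have := period_gt0 N; rewrite muln_gt0 => /andP[].
apply: (@nonhole_eta N); last by apply: small_nonhole => //; lia.
by have -> : (p + n - (p + c) = n - c)%R by ring.
Qed.
End Alignment.
End Toeplitz.

(** * From the image of eta to the whole orbit closure *)

Lemma shiftz_shiftz (n p : int) (x : fullshift) :
  shiftz n (shiftz p x) = shiftz (n + p)%R x.
Proof. by rewrite shiftzD. Qed.

Lemma orbit_commute (U : fullshift -> fullshift) (x : fullshift) :
  (forall n, U (shift (shiftz n x)) = shift (U (shiftz n x))) ->
  forall n, U (shiftz n x) = shiftz n (U x).
Proof.
rewrite -shiftz1 => US.
(* The base point [j] is kept free so that negative powers follow by starting at j = - k and
   climbing back to 0. *)
have UD (k : nat) j :
    U (shiftz (k%:Z + j)%R x) = shiftz k (U (shiftz j x)).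
  elim: k => [|k IH]; first by rewrite shiftz0 add0r.
  by rewrite intS -addrA -shiftz_shiftz US IH shiftz_shiftz.
move=> n; case: (intP n) => [|k|k].
- by rewrite !shiftz0.
- by rewrite -[Posz k.+1 in LHS]addr0 UD shiftz0.
- have := UD k.+1 (- k.+1%:Z)%R; rewrite subrr shiftz0 => ->.
  by rewrite shiftz_shiftz addNr shiftz0.
Qed.

Lemma orbit_closure_eq (U : fullshift -> fullshift) (x : fullshift) (c : int) :
  {within closure [set shiftz n x | n in [set: int]], continuous U} ->
  (forall n, U (shiftz n x) = shiftz c (shiftz n x)) ->
  forall z, closure [set shiftz n x | n in [set: int]] z -> U z = shiftz c z.
Proof.
move=> cU Ux z Xz; apply/funext => m.
have [W hW] := within_cyl m cU Xz.
(* One orbit point agrees with [z] both on the window deciding coordinate [m] of the image and at m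
   + c, which the shift reads. *)
have [_ [[n _ <-] hn]] := Xz _ (nbhs_cyl (maxn W `|(m + c)%R|) z).
rewrite -(hW (shiftz n x)).
- by rewrite Ux /shiftz -hn // leq_max leqnn orbT.
- by apply: subset_closure; exists n.
- by move=> p pW; apply: hn; rewrite leq_max pW.
Qed.

(** Only 2R + 1 shifts compete. If each failed at some coordinate, a window containing one failure
    of each would exclude them all. *)
Lemma shift_of_bounded_shifts (x y : fullshift) (R : nat) :
  (forall W : nat, exists2 c : int, `|c| <= R & cyl W (shiftz c x) y) ->
  exists c, y = shiftz c x.
Proof.
move=> h; apply: contrapT => ny.
have /choice [f hf] c : exists p, y p <> shiftz c x p.
  apply: contrapT => nc; apply: ny; exists c; apply/funext => p.
  by apply: contrapT => np; apply: nc; exists p.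
pose W := \max_(d < (2 * R).+1) `|f (d%:Z - R%:Z)%R|.
have [c cR /(_ (f c)) yc] := h W.
apply: (hf c); apply: yc.
have dR : `|(c + R%:Z)%R| < (2 * R).+1 by lia.
have -> : c = ((Ordinal dR : nat)%:Z - R%:Z)%R by rewrite /=; lia.
exact: (leq_bigmax (Ordinal dR)).
Qed.

Theorem theorem1p1 (b : nat -> nat)
  (b_gt1 : forall i, 0 < i -> 1 < b i)
  (b_odd : forall i, 0 < i -> odd (b i))
  (b_coprime : forall i j, 0 < i -> 0 < j -> i <> j -> coprime (b i) (b j)) :
  trivial_automorphism_group
    (bfree_subshift [set 2 ^ i * b i | i in [set i | 0 < i]]).
Proof.
set B := [set 2 ^ i * b i | i in [set i | 0 < i]].
set X := bfree_subshift B.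
move=> U [[UX cU _] US].
have Xorb n : X (shiftz n (eta B)) by apply: subset_closure; exists n.
have Uorb := @orbit_commute U (eta B) (fun n => US _ (Xorb n)).
have [R hR] := block_code (@closed_closure _ _ : closed X) cU.
(* Commutation with the shift carries the block code from coordinate 0 to every coordinate of U
   eta. *)
have Ublock (i j : int) : (forall d : int, `|d| <= R ->
    eta B (i + d)%R = eta B (j + d)%R) -> U (eta B) i = U (eta B) j.
  have U0 n : U (eta B) n = U (shiftz n (eta B)) 0%R by rewrite Uorb /shiftz add0r.
  move=> ij; rewrite !U0; apply: hR => // m mR.
  by rewrite /shiftz ![(m + _)%R]addrC ij.
have XUeta : X (U (eta B)) by apply: UX; have := Xorb 0%R; rewrite shiftz0.
have [c Uc] : exists c, U (eta B) = shiftz c (eta B).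
  (* Since N < 2^N, this [N] ensures both 2R < 2^N and W + R < 2^N. *)
  apply: (@shift_of_bounded_shifts _ _ R) => W; pose N := (W + 2 * R).+1.
  have N2 : N < 2 ^ N by exact: ltn_expl.
  have [_ [[n _ <-] hn]] := XUeta _ (nbhs_cyl ((2 * b N.+1).+1 * period b N) _).
  have [|||c cR hc] := block_image_eta b_gt1 b_odd b_coprime
    (n := n) (N := N) Ublock.
  - by move=> m mW; rewrite -hn.
  - lia.
  - by [].
  - by exists c => // p pW; apply: hc; lia.
exists c; apply: orbit_closure_eq cU _ => n.
by rewrite Uorb Uc !shiftz_shiftz addrC.
Qed.
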